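(* Let $\mathbb{S}$ be a separable Banach space and let $\pi\colon E\to\mathbb{S}$ and $\pi'\colon E'\to\mathbb{S}$ be non-expansive linear operators, both with the left-Gurariĭ property (with respect to $\mathbb{S}$). If $E$ and $E'$ are separable Banach spaces, then there exists a bijective linear isometry $i\colon E\to E'$ such that $\pi=\pi'\circ i$. In particular, $\pi$ and $\pi'$ are linearly isometric to $\mathbf{P}_{\mathbb{S}}$.
   Context: All spaces are over a fixed scalar field ($\mathbb{R}$ or $\mathbb{C}$). An operator is non-expansive if its norm is at most $1$. For $\varepsilon>0$, an $\varepsilon$-embedding is a linear operator $f$ satisfying $(1-\varepsilon)\|x\|\le\|f(x)\|\le(1+\varepsilon)\|x\|$ for every $x$ in its domain. Left-Gurariĭ property (with respect to a fixed separable Banach space $\mathbb{S}$): a linear operator $P\colon V\to\mathbb{S}$ has it if for all finite-dimensional normed spaces $X_0\subseteq X$, every non-expansive linear operator $T\colon X\to\mathbb{S}$, every linear isometric embedding $e\colon X_0\to V$ such that $P\circ e=T\restriction X_0$, and every $\varepsilon>0$, there exists an $\varepsilon$-embedding $f\colon X\to V$ satisfying $\|f\restriction X_0-e\|\le\varepsilon$ and $\|P\circ f-T\|\le\varepsilon$. $\mathbf{P}_{\mathbb{S}}\colon V_{\mathbb{S}}\to\mathbb{S}$ denotes a non-expansive linear operator with the left-Gurariĭ property, where $V_{\mathbb{S}}$ is a separable Banach space; such an operator is known to exist for every separable Banach space $\mathbb{S}$. Two operators $U,V$ are (linearly) isometric if there are bijective linear isometries $i,j$ (between the respective codomains and domains)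 such that $U\circ j=i\circ V$. *)

(* Defs.v *)
From mathcomp Require Import all_boot all_order all_algebra.
From mathcomp Require Import complex.
From mathcomp Require Import all_classical all_reals all_analysis.
Import numFieldNormedType.Exports.

Set Implicit Arguments.
Unset Strict Implicit.
Unset Printing Implicit Defensive.

Import Order.TTheory GRing.Theory Num.Theory.
Local Open Scope classical_set_scope.
Local Open Scope ring_scope.

(* Norms on a [normedModType K] take their values in [K] itself. For K = R[i],
   [a <= b] means that [b - a] is a nonnegative real, so [0 < eps] says that
   [eps] is a positive real number, and norms are nonnegative reals. *)
Variant real_or_complex (R : realType) : numFieldType -> Prop :=
| RealScalars : real_or_complex R R
| ComplexScalars : real_or_complex R R[i].

Definition separable (T : topologicalType) : Prop :=
  exists D : set T, countable D /\ dense D.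

Definition finite_dimensional (K : numFieldType) (X : lmodType K) : Prop :=
  exists (n : nat) (b : 'I_n -> X),
    forall x, exists c : 'I_n -> K, x = \sum_(i < n) c i *: b i.

Definition linear_subspace (K : numFieldType) (X : lmodType K) (A : set X)
    : Prop :=
  A 0 /\ forall (a : K) (x y : X), A x -> A y -> A (a *: x + y).

(* Operators on a subspace [A] of [X] are represented by functions on [X]
   whose values outside [A] are irrelevant. *)
Definition linear_on (K : numFieldType) (X Y : lmodType K) (A : set X)
    (f : X -> Y) : Prop :=
  forall (a : K) (x y : X), A x -> A y -> f (a *: x + y) = a *: f x + f y.

Definition isometric_on (K : numFieldType) (X Y : normedModType K) (A : set X)
    (f : X -> Y) : Prop :=
  forall x, A x -> `|f x| = `|x|.

(* The operator norm of the restriction of [f] to the subspace [A] is at most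
   [c], for [c >= 0]. *)
Definition opnorm_le (K : numFieldType) (X Y : normedModType K) (A : set X)
    (f : X -> Y) (c : K) : Prop :=
  forall x, A x -> `|f x| <= c * `|x|.

Definition nonexpansive (K : numFieldType) (X Y : normedModType K)
    (f : X -> Y) : Prop :=
  opnorm_le setT f 1.

Definition eps_embedding (K : numFieldType) (X Y : normedModType K) (eps : K)
    (f : {linear X -> Y}) : Prop :=
  forall x, (1 - eps) * `|x| <= `|f x| /\ `|f x| <= (1 + eps) * `|x|.

Definition left_gurarii (K : numFieldType) (V S : normedModType K)
    (P : {linear V -> S}) : Prop :=
  forall (X : normedModType K) (X0 : set X),
    finite_dimensional X -> linear_subspace X0 ->
  forall T : {linear X -> S}, nonexpansive T ->
  forall e : X -> V, linear_on X0 e -> isometric_on X0 e ->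
    (forall x, X0 x -> P (e x) = T x) ->
  forall eps : K, 0 < eps ->
  exists f : {linear X -> V},
    [/\ eps_embedding eps f,
        opnorm_le X0 (fun x => f x - e x) eps &
        opnorm_le setT (fun x => P (f x) - T x) eps].

Definition bijective_isometry (K : numFieldType) (X Y : normedModType K)
    (f : {linear X -> Y}) : Prop :=
  bijective f /\ forall x, `|f x| = `|x|.

Definition linearly_isometric (K : numFieldType) (X Y X' Y' : normedModType K)
    (U : {linear X -> Y}) (V : {linear X' -> Y'}) : Prop :=
  exists (i : {linear Y' -> Y}) (j : {linear X' -> X}),
    [/\ bijective_isometry i, bijective_isometry j &
        forall x, U (j x) = i (V x)].

(* Main.v *)
Require Import Defs.
From mathcomp Require Import all_boot all_order all_algebra.
From mathcomp Require Import all_classical all_reals all_analysis.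
From HB Require Import structures.
From mathcomp Require Import complex.
From mathcomp Require Import ring.
Import numFieldNormedType.Exports.
Import Order.TTheory GRing.Theory Num.Theory.
Local Open Scope classical_set_scope.
Local Open Scope ring_scope.

Set Implicit Arguments.
Unset Strict Implicit.
Unset Printing Implicit Defensive.

(** The isometry [i] with [pi = pi' \o i] is obtained by a back-and-forth
    argument, in which almost isometric maps between finite-dimensional
    subspaces of [E] and [E'] are corrected with ever smaller errors.

    One half-step is [gurarii_back_step]. Let [f : A -> E'] be an
    eps-embedding of a finite-dimensional subspace [A] of [E] such that
    [pi' \o f] is eps-close to [pi] on [A]. On [E * E'] the formula
      [N (x, y) = inf_(w in A) (|x - w| + |y + f w| + eps * |w|)]
    defines a norm for which [x |-> (x, 0)] is isometric on [A],
    [y |-> (0, y)] is isometric on [E'], these two embeddings differ by at most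
    eps along the graph of [f], and [(x, y) |-> pi x + pi' y] is
    non-expansive. The left-Gurarii property of [pi], applied to a
    finite-dimensional subspace [A * B] of [(E * E', N)] and to the inclusion
    of [A * 0] into [E], gives an almost isometric map [g : B -> E]
    such that [pi \o g] is close to [pi'] and [g \o f] is close to the
    identity. The inclusion of [A] need only be defined on [A], so the norm can
    be put on the whole of [E * E'] and restricted afterwards.

    Two half-steps replace [f] by a map [f'] on a larger subspace, with a
    smaller error, close to [f] on [A], and with prescribed vectors of [E] in
    its domain and prescribed vectors of [E'] near its range
    ([back_and_forth_step]). Iterating along dense sequences of [E] and [E']
    with eps equal to the powers of 1/2, the maps converge pointwise on a dense
    subspace of [E] ([limit_graph_total]). The graph of the limit is
    isometric, linear, and has dense domain and dense range, so by completeness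
    its closure is the graph of a bijective isometry
    ([isometric_graph_extension]). The assertion about a third operator
    follows by applying the result to the two pairs it forms. *)

(** * Infima and powers of 1/2 in the scalar field *)

(** [m] is an infimum of [A]; over the complex numbers the order is partial, and
    the lower bounds of a nonempty set of reals are all real. *)
Definition greatest_lower_bound (K : numFieldType) (A : set K) (m : K) : Prop :=
  (forall a, A a -> m <= a) /\ forall l, (forall a, A a -> l <= a) -> l <= m.

Lemma exists_glb (R : realType) (K : numFieldType) (hK : real_or_complex R K)
    (A : set K) :
  A !=set0 -> (forall a, A a -> 0 <= a) -> exists m, greatest_lower_bound A m.
Proof.
case: hK A => A [a0 Aa0] A0.
  exists (inf A); split => [a Aa|l lA].
    by apply: ge_inf => //; exists 0.
  by apply: lb_le_inf => //; exists a0.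
pose B : set R := [set complex.Re a | a in A].
exists ((inf B)%:C)%C; split => [a Aa|l lA].
  have := A0 _ Aa; rewrite !lecE /= => /andP[-> _] /=.
  apply: ge_inf; last by exists a.
  by exists 0 => _ [b Ab <-]; have := A0 _ Ab; rewrite lecE /= => /andP[].
have := A0 _ Aa0; have := lA _ Aa0.
rewrite !lecE /= => /andP[/eqP<- _] /andP[/eqP-> _].
rewrite eqxx /=; apply: lb_le_inf; first by exists (complex.Re a0); exists a0.
by move=> _ [b Ab <-]; have := lA _ Ab; rewrite lecE => /andP[].
Qed.

Lemma half_expn_le (R : realType) (K : numFieldType) (hK : real_or_complex R K)
    (e : K) : 0 < e -> exists n, (2^-1 : K) ^+ n <= e.
Proof.
have realP (r : R) : 0 < r -> exists n, (2^-1 : R) ^+ n <= r.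
  move=> r0; exists (Num.bound r^-1); rewrite exprVn.
  rewrite -[r in _ <= r]invrK lef_pV2 ?posrE ?invr_gt0 ?exprn_gt0 //.
  apply: (le_trans (ltW (archi_boundP _))); first by rewrite invr_ge0 ltW.
  by rewrite -natrX ler_nat ltnW // ltn_expl.
case: hK e => e; first exact: realP.
rewrite ltcE /= => /andP[/eqP ime ree].
have [n hn] := realP _ ree; exists n.
have -> : (2^-1 : R[i]) ^+ n = (((2^-1 : R) ^+ n)%:C)%C.
  by rewrite rmorphXn fmorphV rmorph_nat.
by rewrite lecE /= ime eqxx.
Qed.

(** * Finite-dimensional subspaces as normed spaces *)

(** [N] is a norm on the vector space [W]; nonnegativity follows. *)
Record is_norm (K : numFieldType) (W : lmodType K) (N : W -> K) : Prop := {
  is_norm_triangle : forall x y, N (x + y) <= N x + N y ;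
  is_norm_scale : forall a x, N (a *: x) = `|a| * N x ;
  is_norm_eq0 : forall x, N x = 0 -> x = 0 }.

Section NormedSubspace.
Variables (K : numFieldType) (W : lmodType K) (F : set W).
Variables (hF : linear_subspace F) (N : W -> K) (hN : is_norm N).

(** Membership in [F] as a boolean predicate. *)
Definition subspace_pred : W -> bool := fun x => `[< F x >].

Lemma subspace_pred_closed : subsemimod_closed subspace_pred.
Proof.
case: hF => F0 FD; split; [split => [|x y]|move=> a x] => /=;
  rewrite /subspace_pred !unfold_in.
- exact/asboolP.
- by move=> /asboolP Fx /asboolP Fy; apply/asboolP;
  rewrite -[x]scale1r; apply: FD.
- by move=> /asboolP Fx; apply/asboolP; rewrite -[_ *: _]addr0; apply: FD.
Qed.

Lemma subspace_predP x : reflect (F x) (x \in subspace_pred).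
Proof. exact: asboolP. Qed.

End NormedSubspace.

(** The subspace [F] of [W] as a type of its own, normed by the restriction of
    [N]. The proofs [hF] and [hN] are parameters of the type, so that the
    algebraic and the normed structures can be inferred from it. *)
Record normed_subspace (K : numFieldType) (W : lmodType K) (F : set W)
    (hF : linear_subspace F) (N : W -> K) (hN : is_norm N) := NormedSubspace {
  subspace_val : W;
  subspace_valP : subspace_pred F subspace_val }.

Section NormedSubspaceInstances.
Variables (K : numFieldType) (W : lmodType K) (F : set W).
Variables (hF : linear_subspace F) (N : W -> K) (hN : is_norm N).
Local Notation T := (normed_subspace hF hN).

HB.instance Definition _ := [isSub for @subspace_val K W F hF N hN].
HB.instance Definition _ := [Choice of T by <:].
HB.instance Definition _ :=
  GRing.SubChoice_isSubLmodule.Build K W (subspace_pred F) T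
    (subspace_pred_closed hF).

(** The restriction of [N] to [F]. *)
Definition subspace_norm (x : T) : K := N (val x).

Lemma subspace_normD x y :
  subspace_norm (x + y) <= subspace_norm x + subspace_norm y.
Proof. by rewrite /subspace_norm raddfD; apply: is_norm_triangle. Qed.

Lemma subspace_normZ a x : subspace_norm (a *: x) = `|a| * subspace_norm x.
Proof. by rewrite /subspace_norm linearZ; apply: is_norm_scale. Qed.

Lemma subspace_norm_eq0 x : subspace_norm x = 0 -> x = 0.
Proof. by move=> /(is_norm_eq0 hN) x0; apply: val_inj; rewrite x0 raddf0. Qed.

HB.instance Definition _ := Lmodule_isNormed.Build K T
  subspace_normD subspace_normZ subspace_norm_eq0.

End NormedSubspaceInstances.
Lemma normed_subspace_normE (K : numFieldType) (W : lmodType K) (F : set W)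
    (hF : linear_subspace F) (N : W -> K) (hN : is_norm N)
    (x : normed_subspace hF hN) :
  `|x| = N (val x).
Proof. by []. Qed.

(** * Linear maps on subspaces, and spans *)

Section Subspaces.
Variables (K : numFieldType) (W V : lmodType K).
Implicit Types (A : set W) (f : W -> V).

Lemma linear_subspaceD A x y : linear_subspace A -> A x -> A y -> A (x + y).
Proof. by move=> [_ hA] Ax Ay; rewrite -[x]scale1r; apply: hA. Qed.

Lemma linear_subspaceZ A a x : linear_subspace A -> A x -> A (a *: x).
Proof. by move=> [A0 hA] Ax; rewrite -[_ *: _]addr0; apply: hA. Qed.

Lemma linear_subspaceN A x : linear_subspace A -> A x -> A (- x).
Proof. by rewrite -scaleN1r; apply: linear_subspaceZ. Qed.

Lemma linear_subspaceB A x y : linear_subspace A -> A x -> A y -> A (x - y).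
Proof.
by move=> hA Ax Ay; apply: linear_subspaceD => //; apply: linear_subspaceN.
Qed.

Lemma linear_onD A f x y : linear_on A f -> A x -> A y -> f (x + y) = f x + f y.
Proof. by move=> hf Ax Ay; have := hf 1 _ _ Ax Ay; rewrite !scale1r. Qed.

Lemma linear_on0 A f : linear_subspace A -> linear_on A f -> f 0 = 0.
Proof.
move=> [A0 _] hf; have := linear_onD hf A0 A0; rewrite addr0 => /eqP.
by rewrite -subr_eq0 opprD addNKr oppr_eq0 => /eqP.
Qed.

Lemma linear_onZ A f a x : linear_subspace A -> linear_on A f -> A x ->
  f (a *: x) = a *: f x.
Proof.
move=> hA hf Ax; have [A0 _] := hA.
by have := hf a _ _ Ax A0; rewrite (linear_on0 hA hf) !addr0.
Qed.

Lemma linear_onN A f x : linear_subspace A -> linear_on A f -> A x ->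
  f (- x) = - f x.
Proof.
by move=> hA hf Ax; rewrite -scaleN1r (linear_onZ _ hA hf) // scaleN1r.
Qed.

Lemma linear_onB A f x y : linear_subspace A -> linear_on A f -> A x -> A y ->
  f (x - y) = f x - f y.
Proof.
move=> hA hf Ax Ay; rewrite (linear_onD hf) //; last exact: linear_subspaceN.
by rewrite (linear_onN hA hf).
Qed.

(** The linear lspan of a finite family, as the least linear subspace that
    contains it. *)
Definition lspan (s : seq W) : set W :=
  [set x | forall A, linear_subspace A -> (forall y, y \in s -> A y) -> A x].

Lemma lspan_subspace s : linear_subspace (lspan s).
Proof.
split=> [A [] //|a x y sx sy A hA sA].
by case: (hA) => _; apply; [apply: sx | apply: sy].
Qed.

Lemma mem_lspan s x : x \in s -> lspan s x.
Proof. by move=> xs A _; apply. Qed.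

Lemma lspan_least s A : linear_subspace A -> (forall y, y \in s -> A y) ->
  lspan s `<=` A.
Proof. by move=> hA sA x; apply. Qed.

Lemma lspan_coord s x : lspan s x ->
  exists c : 'I_(size s) -> K, x = \sum_(i < size s) c i *: s`_i.
Proof.
move=> /(_ [set z |
  exists c : 'I_(size s) -> K, z = \sum_(i < size s) c i *: s`_i]).
apply; first split.
- by exists (fun=> 0); rewrite big1 // => i _; rewrite scale0r.
- move=> a _ _ [c ->] [d ->]; exists (fun i => a * c i + d i).
  rewrite scaler_sumr -big_split; apply: eq_bigr => i _.
  by rewrite /= scalerDl scalerA.
move=> y ys; have iy : (index y s < size s)%N by rewrite index_mem.
exists (fun i => (i == Ordinal iy)%:R); rewrite (bigD1 (Ordinal iy)) //= eqxx.
rewrite scale1r nth_index // big1 ?addr0 // => i /negbTE ->.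
by rewrite scale0r.
Qed.

End Subspaces.

Lemma lspan_image (K : numFieldType) (W V : lmodType K) (f : W -> V) s t :
  linear_on (lspan s) f -> (forall x, x \in s -> lspan t (f x)) ->
  forall x, lspan s x -> lspan t (f x).
Proof.
move=> hf hs x sx; have hS := lspan_subspace s; have hT := lspan_subspace t.
have [] // : lspan s x /\ lspan t (f x).
apply: (sx (fun z => lspan s z /\ lspan t (f z))); first split.
- by split; [case: hS | rewrite (linear_on0 hS hf); case: hT].
- move=> a y z [sy ty] [sz tz]; split; first by case: hS => _; apply.
  by rewrite hf //; case: hT => _; apply.
- by move=> y ys; split; [apply: mem_lspan | apply: hs].
Qed.

(** The left-Gurarii property for a finite-dimensional subspace of a vector
    space [W] that carries a norm function [N], without a normed structure
    on [W] itself. The approximate extension [f] is a function on [W] whose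
    values outside the subspace are irrelevant. *)
Lemma gurarii_extension (K : numFieldType) (V S : normedModType K)
    (P : {linear V -> S}) (W : lmodType K) (N : W -> K) (s : seq W)
    (X0 : set W) (T : {linear W -> S}) (e : W -> V) (eps : K) :
  left_gurarii P -> is_norm N -> linear_subspace X0 -> X0 `<=` lspan s ->
  (forall x, `|T x| <= N x) -> linear_on X0 e ->
  (forall x, X0 x -> `|e x| = N x) -> (forall x, X0 x -> P (e x) = T x) ->
  0 < eps ->
  exists f : W -> V,
    [/\ linear_on (lspan s) f,
        forall x, lspan s x -> (1 - eps) * N x <= `|f x| <= (1 + eps) * N x,
        forall x, X0 x -> `|f x - e x| <= eps * N x &
        forall x, lspan s x -> `|P (f x) - T x| <= eps * N x].
Proof.
move=> gP hN hX0 X0s TN elin eN Pe eps0.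
pose F := normed_subspace (lspan_subspace s) hN.
pose T' : {linear F -> S} := T \o (val : {linear F -> W}).
have [||||||f [fe fX0 fT]] :=
  gP F [set x | X0 (val x)] _ _ T' _ (e \o val) _ _ _ _ eps0.
- pose b (i : 'I_(size s)) : F := insubd (0 : F) s`_i.
  have bE i : val (b i) = s`_i.
    rewrite insubdK //; apply/subspace_predP; apply: mem_lspan.
    by rewrite mem_nth.
  exists (size s), b => x.
  have /lspan_coord[c xc] : lspan s (val x).
    by apply/subspace_predP; apply: (valP x).
  exists c; apply: val_inj; rewrite linear_sum xc.
  by apply: eq_bigr => i _; rewrite linearZ /= bE.
- case: hX0 => X00 hX0; split => [|a x y Xx Xy] //.
  exact: hX0.
- by move=> x _; rewrite mul1r; apply: TN.
- by move=> a x y Xx Xy; apply: elin.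
- by move=> x /= Xx; rewrite eN.
- by move=> x /= Xx; apply: Pe.
pose g x := f (insubd (0 : F) x).
have valK x : lspan s x -> val (insubd (0 : F) x) = x.
  by move=> sx; rewrite insubdK //; apply/subspace_predP.
exists g; split.
- move=> a x y sx sy; rewrite /g -linearP; congr (f _); apply: val_inj.
  rewrite linearP /= !valK //.
  by case: (lspan_subspace s) => _; apply.
- move=> x sx; have [] := fe (insubd (0 : F) x).
  by rewrite normed_subspace_normE valK // => -> ->.
- move=> x Xx; have sx := X0s _ Xx.
  have := fX0 (insubd (0 : F) x); rewrite /= valK //.
  by rewrite normed_subspace_normE valK //; apply.
- move=> x sx; have := fT (insubd (0 : F) x) I.
  by rewrite /= valK // normed_subspace_normE valK.
Qed.

(** * The amalgamation of two spaces along an almost isometric map *)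

(** [f] is an eps-embedding of the subspace [A] of [E] into [E'] under which
    [pi'] corresponds to [pi] up to [eps]. *)
Record compatible_embedding (K : numFieldType) (E E' S : normedModType K)
    (pi : {linear E -> S}) (pi' : {linear E' -> S}) (A : set E) (f : E -> E')
    (eps : K) : Prop := {
  compat_linear : linear_on A f ;
  compat_norm : forall x, A x ->
    (1 - eps) * `|x| <= `|f x| <= (1 + eps) * `|x| ;
  compat_comm : forall x, A x -> `|pi' (f x) - pi x| <= eps * `|x| }.

Section Amalgam.
Variables (R : realType) (K : numFieldType) (hK : real_or_complex R K).
Variables (E E' S : normedModType K).
Variables (pi : {linear E -> S}) (pi' : {linear E' -> S}).
Hypotheses (hpi : nonexpansive pi) (hpi' : nonexpansive pi').
Variables (A : set E) (f : E -> E') (eps : K).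
Hypotheses (hA : linear_subspace A) (eps0 : 0 < eps) (eps1 : eps <= 1).
Hypothesis hf : compatible_embedding pi pi' A f eps.
Implicit Types (p q : E * E') (w : E).

(** The length of the decomposition
    [p = (p.1 - w, 0) + (0, p.2 + f w) + (w, - f w)], where the last term is
    charged [eps * |w|]. *)
Definition amalgam_cost p w := `|p.1 - w| + `|p.2 + f w| + eps * `|w|.

(** The infimum of these lengths over [w] in [A]; the default value 0 of [xget]
    is never used, by [amalgam_normP]. *)
Definition amalgam_norm p : K :=
  xget 0 [set m | greatest_lower_bound [set amalgam_cost p w | w in A] m].

Lemma amalgam_cost_ge0 p w : 0 <= amalgam_cost p w.
Proof. by rewrite /amalgam_cost !addr_ge0 // mulr_ge0 // ltW. Qed.

Lemma amalgam_normP p :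
  greatest_lower_bound [set amalgam_cost p w | w in A] (amalgam_norm p).
Proof.
have [m hm] : exists m,
    greatest_lower_bound [set amalgam_cost p w | w in A] m.
  apply: (exists_glb hK).
    by exists (amalgam_cost p 0); exists 0 => //; have [] := hA.
  by move=> _ [w _ <-]; apply: amalgam_cost_ge0.
exact: (xgetI 0 hm).
Qed.

Lemma amalgam_norm_le p w : A w -> amalgam_norm p <= amalgam_cost p w.
Proof. by move=> Aw; have [+ _] := amalgam_normP p; apply; exists w. Qed.

Lemma le_amalgam_norm p l :
  (forall w, A w -> l <= amalgam_cost p w) -> l <= amalgam_norm p.
Proof.
by move=> hl; have [_] := amalgam_normP p; apply => _ [w Aw <-]; apply: hl.
Qed.

Lemma amalgam_norm_ge0 p : 0 <= amalgam_norm p.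
Proof. by apply: le_amalgam_norm => w _; apply: amalgam_cost_ge0. Qed.

Lemma amalgam_normD p q :
  amalgam_norm (p + q) <= amalgam_norm p + amalgam_norm q.
Proof.
rewrite -lerBlDr; apply: le_amalgam_norm => w Aw.
rewrite lerBlDr -lerBlDl; apply: le_amalgam_norm => z Az.
rewrite lerBlDl.
apply: le_trans (amalgam_norm_le _ (linear_subspaceD hA Aw Az)) _.
rewrite /amalgam_cost (linear_onD (compat_linear hf) Aw Az) /=.
have -> : p.1 + q.1 - (w + z) = (p.1 - w) + (q.1 - z).
  by rewrite opprD addrACA.
rewrite (addrACA p.2).
have h1 := ler_normD (p.1 - w) (q.1 - z).
have h2 := ler_normD (p.2 + f w) (q.2 + f z).
have h3 : eps * `|w + z| <= eps * (`|w| + `|z|).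
  by rewrite ler_pM2l // ler_normD.
apply: le_trans (lerD (lerD h1 h2) h3) _.
by rewrite le_eqVlt; apply/orP; left; apply/eqP; ring.
Qed.

Lemma amalgam_normZ_le a p : amalgam_norm (a *: p) <= `|a| * amalgam_norm p.
Proof.
have [->|a0] := eqVneq a 0.
  rewrite scale0r normr0 mul0r; have [A0 _] := hA.
  apply: le_trans (amalgam_norm_le _ A0) _.
  rewrite /amalgam_cost (linear_on0 hA (compat_linear hf)) /=.
  by rewrite subrr addr0 !normr0 mulr0 !addr0.
have na0 : 0 < `|a| by rewrite normr_gt0.
rewrite -ler_pdivrMl //; apply: le_amalgam_norm => w Aw.
rewrite ler_pdivrMl //.
apply: le_trans (amalgam_norm_le _ (linear_subspaceZ a hA Aw)) _.
rewrite /amalgam_cost (linear_onZ _ hA (compat_linear hf) Aw) /=.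
rewrite -scalerBr -scalerDr !normrZ.
by rewrite le_eqVlt; apply/orP; left; apply/eqP; ring.
Qed.

Lemma amalgam_normZ a p : amalgam_norm (a *: p) = `|a| * amalgam_norm p.
Proof.
apply/eqP; rewrite eq_le amalgam_normZ_le /=.
have [->|a0] := eqVneq a 0.
  by rewrite normr0 mul0r amalgam_norm_ge0.
have na0 : 0 < `|a| by rewrite normr_gt0.
rewrite -ler_pdivlMl // -normfV.
by apply: le_trans (amalgam_normZ_le _ _); rewrite scalerA mulVf // scale1r.
Qed.

(** With [amalgam_norm_inr], this yields definiteness: if the norm of [p]
    vanishes, then so does [p.1], and then [p.2]. *)
Lemma fst_le_amalgam_norm p : eps * `|p.1| <= amalgam_norm p.
Proof.
apply: le_amalgam_norm => w Aw; rewrite /amalgam_cost.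
have h : eps * `|p.1| <= eps * (`|p.1 - w| + `|w|).
  by rewrite ler_pM2l //; apply: le_trans (ler_normD _ _); rewrite subrK.
apply: le_trans h _; rewrite mulrDr lerD2r.
apply: (@le_trans _ _ `|p.1 - w|); last by rewrite lerDl.
by rewrite ler_piMl.
Qed.

(** The upper bound [|f w| <= (1 + eps) * |w|] is what makes this embedding
    isometric. *)
Lemma amalgam_norm_inr y : amalgam_norm (0, y) = `|y|.
Proof.
have [A0 _] := hA.
apply/eqP; rewrite eq_le; apply/andP; split.
  apply: le_trans (amalgam_norm_le _ A0) _.
  rewrite /amalgam_cost (linear_on0 hA (compat_linear hf)) /=.
  by rewrite subrr addr0 !normr0 mulr0 add0r addr0.
apply: le_amalgam_norm => w Aw; rewrite /amalgam_cost /= sub0r normrN.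
have /andP[_ fw] := compat_norm hf Aw.
apply: (@le_trans _ _ (`|y + f w| + `|f w|)).
  by have := ler_normB (y + f w) (f w); rewrite addrK.
rewrite -(addrC `|y + f w|) -addrA lerD2l.
by move: fw; rewrite mulrDl mul1r.
Qed.

(** The lower bound [(1 - eps) * |w| <= |f w|] is what makes this embedding
    isometric. *)
Lemma amalgam_norm_inl x : A x -> amalgam_norm (x, 0) = `|x|.
Proof.
move=> Ax; have [A0 _] := hA.
apply/eqP; rewrite eq_le; apply/andP; split.
  apply: le_trans (amalgam_norm_le _ A0) _.
  rewrite /amalgam_cost (linear_on0 hA (compat_linear hf)) /=.
  by rewrite subr0 addr0 !normr0 mulr0 !addr0.
apply: le_amalgam_norm => w Aw; rewrite /amalgam_cost /= add0r.
have /andP[fw _] := compat_norm hf Aw.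
apply: (@le_trans _ _ (`|x - w| + `|w|)).
  by apply: le_trans (ler_normD _ _); rewrite subrK.
rewrite -addrA lerD2l -lerBlDr; apply: le_trans fw.
by rewrite mulrBl mul1r.
Qed.

(** The two embeddings almost agree along the graph of [f]. *)
Lemma amalgam_norm_graph x : A x -> amalgam_norm (- x, f x) <= eps * `|x|.
Proof.
move=> Ax; apply: le_trans (amalgam_norm_le _ (linear_subspaceN hA Ax)) _.
rewrite /amalgam_cost /= opprK addNr (linear_onN hA (compat_linear hf) Ax).
by rewrite subrr !normr0 !add0r normrN.
Qed.

Lemma amalgam_is_norm : is_norm amalgam_norm.
Proof.
split; [exact: amalgam_normD | exact: amalgam_normZ | move=> [x y] N0].
have x0 : x = 0.
  apply/eqP; rewrite -normr_le0 -(pmulr_rle0 _ eps0) -N0.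
  exact: (fst_le_amalgam_norm (x, y)).
move: N0; rewrite x0 amalgam_norm_inr => /eqP; rewrite normr_eq0 => /eqP ->.
by [].
Qed.

(** The common extension of [pi] and [pi'] to the amalgam. *)
Definition amalgam_map p : S := pi p.1 + pi' p.2.

Fact amalgam_map_linear : linear amalgam_map.
Proof.
move=> a p q; rewrite /amalgam_map /= !linearP scalerDr.
by rewrite addrACA.
Qed.

HB.instance Definition _ :=
  GRing.isLinear.Build K (E * E')%type S *:%R amalgam_map amalgam_map_linear.

Lemma amalgam_map_inl x : amalgam_map (x, 0) = pi x.
Proof. by rewrite /amalgam_map /= raddf0 addr0. Qed.

Lemma amalgam_map_inr y : amalgam_map (0, y) = pi' y.
Proof. by rewrite /amalgam_map /= raddf0 add0r. Qed.

Lemma amalgam_map_le p : `|amalgam_map p| <= amalgam_norm p.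
Proof.
apply: le_amalgam_norm => w Aw; rewrite /amalgam_map /amalgam_cost.
have -> : pi p.1 + pi' p.2 =
    pi (p.1 - w) + pi' (p.2 + f w) + - (pi' (f w) - pi w).
  by rewrite linearB linearD addrACA (addrC (- pi w)) addrK.
apply: le_trans (ler_normD _ _) (lerD _ _); last first.
  by rewrite normrN; apply: (compat_comm hf).
apply: le_trans (ler_normD _ _) (lerD _ _).
  by have := hpi (x := p.1 - w) I; rewrite mul1r.
by have := hpi' (x := p.2 + f w) I; rewrite mul1r.
Qed.

End Amalgam.

(** Half a step of the back-and-forth: an approximate left inverse of [f], with
    a prescribed finite-dimensional domain and an arbitrarily small error
    [delta] of its own. *)
Lemma gurarii_back_step (R : realType) (K : numFieldType)
    (hK : real_or_complex R K) (E E' S : normedModType K)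
    (pi : {linear E -> S}) (pi' : {linear E' -> S})
    (s : seq E) (f : E -> E') (eps : K) (t : seq E') (delta : K) :
  nonexpansive pi -> nonexpansive pi' -> left_gurarii pi ->
  0 < eps -> eps <= 1 -> compatible_embedding pi pi' (lspan s) f eps ->
  (forall x, x \in s -> lspan t (f x)) -> 0 < delta ->
  exists g : E' -> E, compatible_embedding pi' pi (lspan t) g delta /\
    forall x, lspan s x -> `|g (f x) - x| <= ((1 + delta) * eps + delta) * `|x|.
Proof.
move=> hpi hpi' gpi eps0 eps1 hf hst delta0.
have hs := lspan_subspace s; have ht := lspan_subspace t.
pose N := amalgam_norm (lspan s) f eps.
have hN : is_norm N := amalgam_is_norm hK hs eps0 eps1 hf.
pose u : seq (E * E') := [seq (x, 0) | x <- s] ++ [seq (0, y) | y <- t].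
have us x : lspan s x -> lspan u (x, 0).
  apply: (@lspan_image _ _ _ (fun x => (x, 0))) => [a y z _ _|y ys].
    by congr (_, _); rewrite /= scaler0 addr0.
  by apply: mem_lspan; rewrite mem_cat map_f.
have ut y : lspan t y -> lspan u (0, y).
  apply: (@lspan_image _ _ _ (fun y => (0, y))) => [a x z _ _|z zt].
    by congr (_, _); rewrite /= scaler0 addr0.
  by apply: mem_lspan; rewrite mem_cat (map_f (fun y => (0, y))) ?orbT.
(* A copy of [A = lspan s] inside the amalgam, to be mapped to [E] by [fst]. *)
pose X0 : set (E * E') := [set p | lspan s p.1 /\ p.2 = 0].
have hX0 : linear_subspace X0.
  split; first by split => //; case: hs.
  move=> a p q [p1 p2] [q1 q2]; split => /=; first by case: hs => _; apply.
  by rewrite p2 q2 scaler0 addr0.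
have [|||||G [Glin Gnorm GX0 Gpi]] := @gurarii_extension K E S pi _ N u X0
  (amalgam_map pi pi') (@fst _ _) delta gpi hN hX0 _ _ _ _ _ delta0.
- by move=> [x y] [/= sx ->]; apply: us.
- exact: (amalgam_map_le hK hpi hpi' hs eps0 hf).
- by [].
- move=> [x y] [/= sx ->].
  by rewrite /N (amalgam_norm_inl hK hs eps0 hf sx).
- by move=> [x y] [/= sx ->]; rewrite amalgam_map_inl.
exists (fun y => G (0, y)); split; first split.
- move=> a y z ty tz; rewrite -(Glin a _ _ (ut _ ty) (ut _ tz)).
  by congr (G (_, _)); rewrite /= scaler0 addr0.
- move=> y ty; have := Gnorm _ (ut _ ty).
  by rewrite /N (amalgam_norm_inr hK hs eps0 hf).
- move=> y ty; have := Gpi _ (ut _ ty).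
  by rewrite /N (amalgam_norm_inr hK hs eps0 hf) /= amalgam_map_inr.
move=> x sx; have tfx := lspan_image (compat_linear hf) hst sx.
have usx := us _ sx; have utfx := ut _ tfx; have hu := lspan_subspace u.
have -> : G (0, f x) - x = G (- x, f x) + (G (x, 0) - (x, 0 : E').1).
  have -> : (- x, f x) = (0, f x) - (x, 0).
    by congr (_, _); rewrite /= ?sub0r ?subr0.
  by rewrite (linear_onB hu Glin) // addrA subrK.
rewrite mulrDl; apply: le_trans (ler_normD _ _) (lerD _ _); last first.
  have := GX0 (x, 0) (conj sx erefl).
  by rewrite /N (amalgam_norm_inl hK hs eps0 hf sx).
have uxx : lspan u (- x, f x).
  have -> : (- x, f x) = (0, f x) - (x, 0).
    by congr (_, _); rewrite /= ?sub0r ?subr0.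
  exact: (linear_subspaceB hu utfx usx).
have /andP[_ h] := Gnorm _ uxx; apply: le_trans h _.
rewrite -mulrA ler_pM2l; last by rewrite addr_gt0.
exact: (amalgam_norm_graph hK hs eps0 hf sx).
Qed.

(** * Extension of a densely defined isometric relation *)

(** Positive scalars are comparable even if the order of [K] is partial. *)
Lemma exists_le_both (K : numFieldType) (a b : K) : 0 < a -> 0 < b ->
  exists c, [/\ 0 < c, c <= a & c <= b].
Proof.
move=> a0 b0; case: (real_leP (gtr0_real a0) (gtr0_real b0)) => ab.
  by exists a.
by exists b; split => //; apply: ltW.
Qed.

Section IsometricGraph.
Variables (K : numFieldType).

(** The closure of the relation [G] in [E * E']. *)
Definition graph_closure (E E' : normedModType K) (G : E -> E' -> Prop) x y :=
  forall e : K, 0 < e -> exists a b, [/\ G a b, `|x - a| < e & `|y - b| < e].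

(** [G] is stable under linear combinations, as the graph of a linear
    map is. *)
Definition linear_graph (E E' : normedModType K) (G : E -> E' -> Prop) :=
  forall (a : K) x y x' y', G x y -> G x' y' -> G (a *: x + x') (a *: y + y').

(** Related vectors have the same norm. With linearity, this makes [G] the
    graph of an injective map on its domain. *)
Definition isometric_graph (E E' : normedModType K) (G : E -> E' -> Prop) :=
  forall x y, G x y -> `|y| = `|x|.

(** The vectors related to some vector are dense in [E]. The same notion for the
    converse relation says that the range of [G] is dense. *)
Definition dense_graph_domain (E E' : normedModType K) (G : E -> E' -> Prop) :=
  forall x (e : K), 0 < e -> exists a b, G a b /\ `|x - a| < e.

Lemma graph_closure_total (E : normedModType K) (E' : completeNormedModType K)
    (G : E -> E' -> Prop) :
  linear_graph G -> isometric_graph G -> dense_graph_domain G ->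
  forall x, exists y, graph_closure G x y.
Proof.
move=> Glin Giso Gdom x.
have Gdist a b a' b' : G a b -> G a' b' -> `|b - b'| = `|a - a'|.
  move=> Gab Gab'; apply: Giso.
  have := Glin (-1) _ _ _ _ Gab' Gab.
  by rewrite !scaleN1r !(addrC (- _)).
(* The sets of those [b] related to a point close to [x] form the base of a
   Cauchy filter, and its limit is the sought image of [x]. *)
pose B (e : K) : set E' := [set b | exists a, G a b /\ `|x - a| < e].
have BS (d e : K) : d <= e -> B d `<=` B e.
  by move=> de b [a [Gab ha]]; exists a; split => //; apply: lt_le_trans de.
pose F := filter_from [set e : K | 0 < e] B.
have FF : Filter F.
  apply: filter_from_filter; first by exists 1; apply: ltr01.
  move=> d e /= d0 e0; have [c [c0 cd ce]] := exists_le_both d0 e0.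
  by exists c => // b Bb; split; [apply: BS cd _ Bb | apply: BS ce _ Bb].
have PF : ProperFilter F.
  apply: filter_from_proper => // e /= e0.
  by have [a [b [Gab ha]]] := Gdom x e e0; exists b, a.
have /cauchy_cvg Fcvg : cauchy F.
  apply: cauchy_exP => e e0; have e20 : 0 < e / 2 by rewrite divr_gt0.
  have [a [b [Gab ha]]] := Gdom x (e / 2) e20.
  exists b, (e / 2) => // b' [a' [Gab' ha']].
  rewrite -ball_normE /= (Gdist _ _ _ _ Gab Gab') (splitr e).
  apply: le_lt_trans (ler_distD x _ _) _.
  by apply: ltrD => //; rewrite distrC.
exists (lim F) => e e0.
have [d /= d0 hd] := Fcvg _ (nbhsx_ballx (lim F) e e0).
have [c [c0 cd ce]] := exists_le_both d0 e0.
have [a [b [Gab ha]]] := Gdom x c c0.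
exists a, b; split => //; first exact: lt_le_trans ce.
have := hd b; rewrite -ball_normE /=; apply.
by exists a; split => //; apply: lt_le_trans cd.
Qed.

Lemma linear_graph_closure (E E' : normedModType K) (G : E -> E' -> Prop) :
  linear_graph G -> linear_graph (graph_closure G).
Proof.
move=> Glin a x y x' y' Hxy Hxy' e e0.
pose d : K := e / (`|a| + 1).
have a1 : 0 < `|a| + 1 by rewrite ltr_wpDl.
have d0 : 0 < d by rewrite divr_gt0.
have [u [v [Guv xu yv]]] := Hxy d d0.
have [u' [v' [Guv' xu' yv']]] := Hxy' d d0.
have de : e = `|a| * d + d.
  by rewrite /d -[X in _ + X]mul1r -mulrDl mulrC divfK ?gt_eqF.
have near (V : normedModType K) (p q p' q' : V) :
    `|p - q| < d -> `|p' - q'| < d ->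
    `|a *: p + p' - (a *: q + q')| < e.
  move=> h h'; rewrite opprD addrACA -scalerBr.
  apply: le_lt_trans (ler_normD _ _) _; rewrite de normrZ.
  by apply: ler_ltD => //; rewrite ler_wpM2l // ltW.
exists (a *: u + u'), (a *: v + v').
by split; [apply: Glin | apply: near | apply: near].
Qed.

Lemma isometric_graph_closure (E E' : normedModType K) (G : E -> E' -> Prop) :
  isometric_graph G -> isometric_graph (graph_closure G).
Proof.
move=> Giso x y Hxy; apply/eqP; rewrite -subr_eq0 -normr_le0.
apply/ler_addgt0Pr => e e0; rewrite add0r.
have e20 : 0 < e / 2 by rewrite divr_gt0.
have [a [b [Gab xa yb]]] := Hxy _ e20.
have -> : `|y| - `|x| = (`|y| - `|b|) + (`|a| - `|x|).
  by rewrite (Giso _ _ Gab) addrA subrK.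
rewrite (splitr e); apply: le_trans (ler_normD _ _) (lerD _ _).
  by apply: le_trans (ler_dist_dist _ _) (ltW _).
by apply: le_trans (ler_dist_dist _ _) _; rewrite distrC ltW.
Qed.

Lemma isometric_graph_extension (E E' : completeNormedModType K)
    (G : E -> E' -> Prop) :
  linear_graph G -> isometric_graph G ->
  dense_graph_domain G -> dense_graph_domain (fun y x => G x y) ->
  exists i : {linear E -> E'},
    bijective_isometry i /\ forall x y, G x y -> i x = y.
Proof.
move=> Glin Giso Gdom Gran; pose H := graph_closure G.
have Hlin : linear_graph H by apply: linear_graph_closure.
have Hiso : isometric_graph H by apply: isometric_graph_closure.
have Hdist x y x' y' : H x y -> H x' y' -> `|y - y'| = `|x - x'|.
  move=> Hxy Hxy'; apply: Hiso.
  have := Hlin (-1) _ _ _ _ Hxy' Hxy.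
  by rewrite !scaleN1r !(addrC (- _)).
have [i Hi] := choice (graph_closure_total Glin Giso Gdom).
have [j Hj] : {j : E' -> E & forall y, H (j y) y}.
  apply: (@choice _ _ (fun y x => H x y)) => y.
  have [||x hx] := graph_closure_total _ _ Gran y.
  - by move=> a u v u' v' Guv Guv'; apply: Glin.
  - by move=> u v Guv; rewrite (Giso _ _ Guv).
  exists x => e e0; have [v [u [Guv yv xu]]] := hx e e0.
  by exists u, v.
have iE x y : H x y -> i x = y.
  move=> Hxy; apply/eqP; rewrite -subr_eq0 -normr_eq0.
  by rewrite (Hdist _ _ _ _ (Hi x) Hxy) subrr normr0.
have jE x y : H x y -> j y = x.
  move=> Hxy; apply/eqP; rewrite -subr_eq0 -normr_eq0.
  by rewrite -(Hdist _ _ _ _ (Hj y) Hxy) subrr normr0.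
have ilin : linear i.
  by move=> a x x'; apply: iE; exact: (Hlin _ _ _ _ _ (Hi x) (Hi x')).
pose iM := GRing.isLinear.Build K E E' *:%R i ilin.
pose i' : {linear E -> E'} := HB.pack i iM.
exists i'; split; first split.
- by exists j => [x|y]; [apply: (jE _ _ (Hi x)) | apply: (iE _ _ (Hj y))].
- by move=> x; apply: (Hiso _ _ (Hi x)).
move=> x y Gxy; apply: iE => e e0.
by exists x, y; split => //; rewrite subrr normr0.
Qed.

End IsometricGraph.

(** * Back and forth *)

Lemma separable_dense_sequence (K : numFieldType) (E : normedModType K) :
  separable E -> exists d : nat -> E,
    forall x (e : K), 0 < e -> exists n, `|x - d n| < e.
Proof.
move=> [D [/countable_injP[c cinj] Dd]].
exists (fun n => xget 0 [set x | D x /\ c x = n]) => x e e0.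
have [z [hz Dz]] : (ball x e)° `&` D !=set0.
  by apply: Dd; [exists x; apply: nbhsx_ballx | apply: open_interior].
exists (c z); case: xgetP => [y _ [Dy cy]|/(_ z)]; last by case.
have -> : y = z by apply: cinj; rewrite ?inE.
by have := interior_subset hz; rewrite -ball_normE.
Qed.

Section BackAndForth.
Variables (R : realType) (K : numFieldType) (hK : real_or_complex R K).

Lemma half_expn_gt0 n : 0 < (2^-1 : K) ^+ n.
Proof. by rewrite exprn_gt0 // invr_gt0. Qed.

Lemma half_expn_le1 n : (2^-1 : K) ^+ n <= 1.
Proof. by rewrite exprn_ile1 // ?invr_ge0 // invf_le1 // ler1n. Qed.

Lemma half_expn_mono m n : (m <= n)%N -> (2^-1 : K) ^+ n <= 2^-1 ^+ m.
Proof.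
by move=> mn; rewrite -(subnK mn) exprD ler_piMl ?half_expn_le1.
Qed.

Lemma half_expn_small (C e : K) n : 0 <= C -> 0 < e ->
  exists2 k, (n <= k)%N & C * 2^-1 ^+ k < e.
Proof.
move=> C0 e0; have C1 : 0 < C + 1 by rewrite ltr_wpDl.
have [m hm] := half_expn_le hK (divr_gt0 e0 C1).
exists (maxn n m); first exact: leq_maxl.
apply: (@lt_le_trans _ _ ((C + 1) * 2^-1 ^+ maxn n m)).
  by rewrite ltr_pM2r ?half_expn_gt0 // ltrDl.
rewrite mulrC -ler_pdivlMr //; apply: le_trans hm.
exact/half_expn_mono/leq_maxr.
Qed.

Lemma half_expn_vanish (C r : K) n : 0 <= C ->
  (forall k, (n <= k)%N -> r <= C * 2^-1 ^+ k) -> r <= 0.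
Proof.
move=> C0 hr; apply/ler_addgt0Pr => e e0; rewrite add0r.
have [k nk hk] := half_expn_small n C0 e0.
exact: le_trans (hr _ nk) (ltW hk).
Qed.

(** A whole step: from [f] to a map [f'] with error [delta], defined at the
    vectors of [a] and almost attaining those of [b]. *)
Lemma back_and_forth_step (E E' S : normedModType K)
    (pi : {linear E -> S}) (pi' : {linear E' -> S})
    (s : seq E) (f : E -> E') (eps delta : K) (a : seq E) (b : seq E') :
  nonexpansive pi -> nonexpansive pi' -> left_gurarii pi -> left_gurarii pi' ->
  0 < delta -> delta <= eps -> eps <= 1 ->
  compatible_embedding pi pi' (lspan s) f eps ->
  exists s' f',
    [/\ compatible_embedding pi pi' (lspan s') f' delta,
        lspan s `<=` lspan s',
        forall x, x \in a -> lspan s' x,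
        forall x, lspan s x -> `|f' x - f x| <= 12 * eps * `|x| &
        forall y, y \in b -> exists2 x, lspan s' x &
          `|x| <= 2 * `|y| /\ `|f' x - y| <= 3 * eps * `|y|].
Proof.
move=> hpi hpi' gpi gpi' delta0 de eps1 hf.
have eps0 : 0 < eps by apply: lt_le_trans de.
have delta1 : delta <= 1 by apply: le_trans eps1.
pose t := map f s ++ b.
have hst x : x \in s -> lspan t (f x).
  by move=> xs; apply: mem_lspan; rewrite mem_cat map_f.
have [g [hg gf]] := gurarii_back_step hK hpi hpi' gpi eps0 eps1 hf hst eps0.
pose s' := s ++ map g t ++ a.
have hts' y : y \in t -> lspan s' (g y).
  by move=> yt; apply: mem_lspan; rewrite !mem_cat map_f ?orbT.
have [f' [hf' f'g]] :=
  gurarii_back_step hK hpi' hpi gpi' eps0 eps1 hg hts' delta0.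
have hs' := lspan_subspace s'.
have ss' : lspan s `<=` lspan s'.
  by apply: lspan_least => // x xs; apply: mem_lspan; rewrite mem_cat xs.
have d2 : 1 + delta <= 2 by rewrite [2]mulr2n lerD2l.
have e2 : 1 + eps <= 2 by rewrite [2]mulr2n lerD2l.
(* Since [1 + r <= 2], both compositions differ from the identity by at most
   [2 * eps + eps] times the norm. *)
have three r : r <= 1 -> r <= eps -> (1 + r) * eps + r <= 3 * eps.
  move=> r1 re; have -> : 3 * eps = 2 * eps + eps by ring.
  by apply: lerD => //; rewrite ler_pM2r // [2]mulr2n lerD2l.
have gf3 x : lspan s x -> `|g (f x) - x| <= 3 * eps * `|x|.
  move=> sx; apply: le_trans (gf _ sx) _.
  by rewrite ler_wpM2r // three.
have f'g3 y : lspan t y -> `|f' (g y) - y| <= 3 * eps * `|y|.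
  move=> ty; apply: le_trans (f'g _ ty) _.
  by rewrite ler_wpM2r // three.
have f'2 x : lspan s' x -> `|f' x| <= 2 * `|x|.
  move=> sx; have /andP[_ h] := compat_norm hf' sx.
  by apply: le_trans h _; rewrite ler_wpM2r.
have f2 x : lspan s x -> `|f x| <= 2 * `|x|.
  move=> sx; have /andP[_ h] := compat_norm hf sx.
  by apply: le_trans h _; rewrite ler_wpM2r.
have g2 y : lspan t y -> `|g y| <= 2 * `|y|.
  move=> ty; have /andP[_ h] := compat_norm hg ty.
  by apply: le_trans h _; rewrite ler_wpM2r.
exists s', f'; split => //.
- by move=> x xa; apply: mem_lspan; rewrite !mem_cat xa !orbT.
- move=> x sx; have s'x := ss' _ sx.
  have tfx := lspan_image (compat_linear hf) hst sx.
  have s'gfx := lspan_image (compat_linear hg) hts' tfx.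
  (* Go through [f' (g (f x))]: it is close to [f x], as [f' \o g] is almost the
     identity, and close to [f' x], as [g (f x)] is close to [x]. *)
  have -> : f' x - f x = (f' (g (f x)) - f x) - f' (g (f x) - x).
    rewrite (linear_onB hs' (compat_linear hf')) // opprB.
    by rewrite [RHS]addrC addrA subrK.
  apply: le_trans (ler_normB _ _) _.
  have -> : 12 * eps * `|x| = 3 * eps * (2 * `|x|) + 2 * (3 * eps * `|x|).
    by ring.
  apply: lerD.
    apply: le_trans (f'g3 _ tfx) _.
    by rewrite ler_wpM2l ?f2 // mulr_ge0 // ltW.
  apply: le_trans (f'2 _ _) _.
    exact: (linear_subspaceB hs' s'gfx (ss' _ sx)).
  by rewrite ler_wpM2l ?gf3.
move=> y yb; have ty : lspan t y by apply: mem_lspan; rewrite mem_cat yb orbT.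
exists (g y); last by split; [apply: g2 | apply: f'g3].
exact: (lspan_image (compat_linear hg) hts' ty).
Qed.

(** The clause on [b k] is required for all [k <= n], not only for [k = n], so
    that each [b k] is almost attained with arbitrarily small error. *)
Lemma back_and_forth_sequence (E E' S : normedModType K)
    (pi : {linear E -> S}) (pi' : {linear E' -> S})
    (a : nat -> E) (b : nat -> E') :
  nonexpansive pi -> nonexpansive pi' -> left_gurarii pi -> left_gurarii pi' ->
  exists (s : nat -> seq E) (f : nat -> E -> E'), forall n,
    [/\ compatible_embedding pi pi' (lspan (s n)) (f n) (2^-1 ^+ n),
        lspan (s n) `<=` lspan (s n.+1),
        lspan (s n.+1) (a n),
        forall x, lspan (s n) x ->
          `|f n.+1 x - f n x| <= 12 * 2^-1 ^+ n * `|x| &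
        forall k, (k <= n)%N -> exists2 x, lspan (s n.+1) x &
          `|x| <= 2 * `|b k| /\ `|f n.+1 x - b k| <= 3 * 2^-1 ^+ n * `|b k|].
Proof.
move=> hpi hpi' gpi gpi'.
pose good n (st : seq E * (E -> E')) :=
  compatible_embedding pi pi' (lspan st.1) st.2 (2^-1 ^+ n).
pose next n (st st' : seq E * (E -> E')) :=
  [/\ good n.+1 st', lspan st.1 `<=` lspan st'.1,
      lspan st'.1 (a n),
      forall x, lspan st.1 x -> `|st'.2 x - st.2 x| <= 12 * 2^-1 ^+ n * `|x| &
      forall k, (k <= n)%N -> exists2 x, lspan st'.1 x &
        `|x| <= 2 * `|b k| /\ `|st'.2 x - b k| <= 3 * 2^-1 ^+ n * `|b k|].
have step n st : good n st -> exists st', next n st st'.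
  move=> hst.
  have [s' [f' [h1 h2 h3 h4 h5]]] := back_and_forth_step [:: a n] (mkseq b n.+1)
    hpi hpi' gpi gpi' (half_expn_gt0 n.+1) (half_expn_mono (leqnSn n))
    (half_expn_le1 n) hst.
  exists (s', f'); split => //; first by apply: h3; rewrite inE.
  by move=> k kn; apply: h5; apply: map_f; rewrite mem_iota.
pose T := {p : nat * (seq E * (E -> E')) | good p.1 p.2}.
pose next' (p q : T) := (sval q).1 = (sval p).1.+1 /\
  next (sval p).1 (sval p).2 (sval q).2.
have step' (p : T) : {q | next' p q}.
  apply: cid; case: p => [[n st] /= hst]; have [st' h] := step _ _ hst.
  by have [h1 _ _ _ _] := h; exists (exist _ (n.+1, st') h1); split.
(* The initial subspace is 0, and the error is 1: the zero map qualifies since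
   [pi] is non-expansive. *)
have good0 : good 0%N ([::], fun=> 0).
  rewrite /good expr0; split => /= [c x y _ _|x|x _].
  - by rewrite scaler0 addr0.
  - move=> h; have -> : x = 0.
      apply: (h [set z | z = 0]) => //; split=> // c y z -> ->.
      by rewrite scaler0 addr0.
    by rewrite !normr0 !mulr0 lexx.
  - by rewrite linear0 sub0r normrN; apply: hpi.
have [u [u0 hu]] :=
  dependent_choice step' (exist _ (0%N, ([::], fun=> 0)) good0).
have un n : (sval (u n)).1 = n.
  by elim: n => [|n IH]; [rewrite u0 | have [-> _] := hu n; rewrite IH].
exists (fun n => (sval (u n)).2.1), (fun n => (sval (u n)).2.2) => n.
have [_] := hu n; rewrite un => -[_ h2 h3 h4 h5]; split => //.
by have := svalP (u n); rewrite un.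
Qed.

Section LimitGraph.
Variables (E S : normedModType K) (E' : completeNormedModType K).
Variables (pi : {linear E -> S}) (pi' : {linear E' -> S}).
Hypotheses (hpi : nonexpansive pi) (hpi' : nonexpansive pi').
Variables (s : nat -> seq E) (f : nat -> E -> E').
Hypothesis hf : forall n,
  compatible_embedding pi pi' (lspan (s n)) (f n) (2^-1 ^+ n).
Hypothesis hs : forall n, lspan (s n) `<=` lspan (s n.+1).
Hypothesis hcauchy : forall n x, lspan (s n) x ->
  `|f n.+1 x - f n x| <= 12 * 2^-1 ^+ n * `|x|.

(** [x] is eventually in the domain of [f k], and [f k x] tends to [y] at
    geometric speed. The constant [C] is not required to be proportional to the
    norm of [x], as such a bound would not be stable under sums. *)
Definition limit_graph (x : E) (y : E') : Prop :=
  exists C n, 0 <= C /\ forall k, (n <= k)%N ->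
    lspan (s k) x /\ `|f k x - y| <= C * 2^-1 ^+ k.

Lemma lspan_mono m n : (m <= n)%N -> lspan (s m) `<=` lspan (s n).
Proof.
move=> /subnK <-; elim: (n - m)%N => // k IH x /IH.
exact: hs.
Qed.

Lemma linear_limit_graph : linear_graph limit_graph.
Proof.
move=> a x y x' y' [C [n [C0 h]]] [C' [n' [C'0 h']]].
exists (`|a| * C + C'), (maxn n n'); split.
  by rewrite addr_ge0 // mulr_ge0.
move=> k; rewrite geq_max => /andP[nk nk'].
have [sx fx] := h _ nk; have [sx' fx'] := h' _ nk'.
split; first by have [_] := lspan_subspace (s k); apply.
rewrite (compat_linear (hf k)) // opprD addrACA -scalerBr.
apply: le_trans (ler_normD _ _) _; rewrite mulrDl -mulrA normrZ.
by apply: lerD => //; apply: ler_wpM2l.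
Qed.

Lemma isometric_limit_graph : isometric_graph limit_graph.
Proof.
move=> x y [C [n [C0 h]]]; apply/eqP; rewrite -subr_eq0 -normr_le0.
apply: (@half_expn_vanish (C + `|x|) _ n); first by rewrite addr_ge0.
move=> k nk; have [sx fx] := h _ nk.
have -> : `|y| - `|x| = (`|y| - `|f k x|) + (`|f k x| - `|x|).
  by rewrite addrA subrK.
rewrite mulrDl; apply: le_trans (ler_normD _ _) (lerD _ _).
  by apply: le_trans (ler_dist_dist _ _) _; rewrite distrC.
rewrite real_ler_distl; last by rewrite rpredB // normr_real.
by have := compat_norm (hf k) sx; rewrite mulrBl mulrDl mul1r (mulrC `|x|).
Qed.

Lemma limit_graph_comm x y : limit_graph x y -> pi x = pi' y.
Proof.
move=> [C [n [C0 h]]]; apply/eqP; rewrite -subr_eq0 -normr_le0.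
apply: (@half_expn_vanish (C + `|x|) _ n); first by rewrite addr_ge0.
move=> k nk; have [sx fx] := h _ nk.
have -> : pi x - pi' y = pi' (f k x - y) - (pi' (f k x) - pi x).
  by rewrite linearB opprB [RHS]addrC addrA subrK.
rewrite mulrDl; apply: le_trans (ler_normB _ _) (lerD _ _).
  apply: le_trans fx; have := hpi' (x := f k x - y) I.
  by rewrite mul1r.
by have := compat_comm (hf k) sx; rewrite mulrC.
Qed.

(** The factor 24 is twice 12, for the telescoping sum of the powers
    of 1/2. *)
Lemma limit_graph_cauchy n x : lspan (s n) x -> forall k,
  `|f (n + k)%N x - f n x| <= 24 * (2^-1 ^+ n - 2^-1 ^+ (n + k)) * `|x|.
Proof.
move=> sx; elim=> [|k IH]; first by rewrite addn0 !subrr normr0 mulr0 mul0r.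
rewrite addnS; apply: le_trans (ler_distD (f (n + k)%N x) _ _) _.
have -> : 24 * (2^-1 ^+ n - 2^-1 ^+ (n + k).+1) * `|x| =
    12 * 2^-1 ^+ (n + k) * `|x| +
    24 * (2^-1 ^+ n - 2^-1 ^+ (n + k)) * `|x| :> K.
  by rewrite exprS; field.
by apply: lerD => //; apply: hcauchy; apply: (lspan_mono (leq_addr _ _)).
Qed.

Lemma limit_graph_total n x : lspan (s n) x -> exists2 y, limit_graph x y &
  forall k, (n <= k)%N -> `|f k x - y| <= 24 * 2^-1 ^+ k * `|x|.
Proof.
move=> sx; have C0 : 0 <= 24 * `|x| by rewrite mulr_ge0.
have bound k l : (n <= k)%N -> (k <= l)%N ->
    `|f l x - f k x| <= 24 * 2^-1 ^+ k * `|x|.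
  move=> nk kl; rewrite -(subnKC kl).
  apply: le_trans (limit_graph_cauchy (lspan_mono nk sx) _) _.
  rewrite ler_wpM2r // ler_wpM2l // lerBlDr lerDl.
  exact/ltW/half_expn_gt0.
have /cauchy_cvg fcvg : cauchy (f ^~ x @ \oo).
  apply: cauchy_exP => e e0; have [m nm hm] := half_expn_small n C0 e0.
  exists (f m x); exists m => // k /= mk.
  rewrite -ball_normE /= distrC; apply: le_lt_trans (bound _ _ nm mk) _.
  by rewrite mulrAC.
pose y := lim (f ^~ x @ \oo).
have fy k : (n <= k)%N -> `|f k x - y| <= 24 * 2^-1 ^+ k * `|x|.
  move=> nk; apply/ler_addgt0Pr => e e0.
  have /cvgrPdist_lt /(_ e e0)[m _ hm] := fcvg.
  have hl := hm (maxn k m) (leq_maxr _ _).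
  apply: le_trans (ler_distD (f (maxn k m) x) _ _) (lerD _ _).
    by rewrite distrC; apply: bound => //; apply: leq_maxl.
  by rewrite distrC; apply: ltW.
exists y => //; exists (24 * `|x|), n; split => // k nk.
by split; [apply: lspan_mono sx | rewrite mulrAC; apply: fy].
Qed.

End LimitGraph.

(** A non-expansive operator with the left-Gurarii property on a separable
    Banach space is unique up to a bijective isometry of the domains. *)
Lemma gurarii_uniqueness (S E E' : completeNormedModType K)
    (pi : {linear E -> S}) (pi' : {linear E' -> S}) :
  separable E -> separable E' -> nonexpansive pi -> nonexpansive pi' ->
  left_gurarii pi -> left_gurarii pi' ->
  exists i : {linear E -> E'},
    bijective_isometry i /\ forall x : E, pi x = pi' (i x).
Proof.
move=> hE hE' hpi hpi' gpi gpi'.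
have [a ha] := separable_dense_sequence hE.
have [b hb] := separable_dense_sequence hE'.
have [s [f hsf]] := back_and_forth_sequence a b hpi hpi' gpi gpi'.
have hf n : compatible_embedding pi pi' (lspan (s n)) (f n) (2^-1 ^+ n).
  by have [] := hsf n.
have hs n : lspan (s n) `<=` lspan (s n.+1) by have [] := hsf n.
have hc n x : lspan (s n) x -> `|f n.+1 x - f n x| <= 12 * 2^-1 ^+ n * `|x|.
  by have [_ _ _ h _] := hsf n; apply: h.
pose G := limit_graph s f.
have Gdom : dense_graph_domain G.
  move=> x e e0; have [n xn] := ha x e e0; exists (a n).
  have [_ _ sn _ _] := hsf n.
  by have [y Gy _] := limit_graph_total hs hc sn; exists y.
have Gran : dense_graph_domain (fun y x => G x y).
  move=> y e e0; have e20 : 0 < e / 2 by rewrite divr_gt0.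
  have [k yk] := hb y _ e20.
  (* 51 = 3 + 24 * 2: [f n.+1 x] is within [3 * 2^-1 ^+ n * |b k|] of [b k], and
     within [24 * 2^-1 ^+ n * |x|] of its limit, where [|x| <= 2 * |b k|]. *)
  have C0 : 0 <= 51 * `|b k| by rewrite mulr_ge0.
  have [n kn hn] := half_expn_small k C0 e20.
  have [_ _ _ _ /(_ k kn)[x sx [x2 fx]]] := hsf n.
  have [z Gxz /(_ n.+1 (leqnn _)) fz] := limit_graph_total hs hc sx.
  exists z, x; split => //; rewrite (splitr e).
  apply: le_lt_trans (ler_distD (b k) _ _) (ltrD yk _).
  apply: le_lt_trans hn; apply: le_trans (ler_distD (f n.+1 x) _ _) _.
  have -> : 51 * `|b k| * 2^-1 ^+ n =
     3 * 2^-1 ^+ n * `|b k| + 24 * 2^-1 ^+ n * (2 * `|b k|) by ring.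
  apply: lerD; first by rewrite distrC.
  apply: le_trans fz _; apply: ler_pM => //.
  by rewrite ler_wpM2l // half_expn_mono.
have [i [iiso iG]] := isometric_graph_extension (linear_limit_graph hf)
  (isometric_limit_graph hf) Gdom Gran.
(* [pi = pi' \o i] holds on a dense set, hence everywhere as the operators are
   non-expansive. *)
exists i; split=> // x; apply/eqP; rewrite -subr_eq0 -normr_le0.
apply/ler_addgt0Pr => e e0; rewrite add0r.
have [u [v [Guv xu]]] := Gdom x _ (divr_gt0 e0 (ltr0n K 2)).
have -> : pi x - pi' (i x) = pi (x - u) - pi' (i (x - u)).
  rewrite (linearB pi) (linearB i) (linearB pi') (iG _ _ Guv).
  rewrite (limit_graph_comm hpi' hf Guv) opprB.
  by rewrite addrA subrK.
have [_ inorm] := iiso; rewrite (splitr e).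
apply: le_trans (ler_normB _ _) (lerD _ _).
  by apply: le_trans (hpi _ I) _; rewrite mul1r ltW.
by apply: le_trans (hpi' _ I) _; rewrite mul1r inorm ltW.
Qed.

End BackAndForth.

Lemma id_bijective_isometry (K : numFieldType) (S : normedModType K) :
  bijective_isometry (idfun : {linear S -> S}).
Proof. by split=> //; exists id. Qed.

Theorem theorem3p2 (R : realType) (K : numFieldType)
    (hK : real_or_complex R K)
    (S E E' : completeNormedModType K)
    (hS : separable S) (hE : separable E) (hE' : separable E')
    (pi : {linear E -> S}) (pi' : {linear E' -> S})
    (hpi : nonexpansive pi) (hpi' : nonexpansive pi')
    (gpi : left_gurarii pi) (gpi' : left_gurarii pi') :
  (exists i : {linear E -> E'},
      bijective_isometry i /\ forall x : E, pi x = pi' (i x)) /\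
  (forall (V : completeNormedModType K) (P : {linear V -> S}),
      separable V -> nonexpansive P -> left_gurarii P ->
      linearly_isometric pi P /\ linearly_isometric pi' P).
Proof.
split=> [|V P hV hP gP].
  exact: (gurarii_uniqueness hK).
have [j [jiso jP]] := gurarii_uniqueness hK hV hE hP hpi gP gpi.
have [j' [j'iso j'P]] := gurarii_uniqueness hK hV hE' hP hpi' gP gpi'.
have idiso := id_bijective_isometry S.
split.
  by exists idfun, j; split=> // x; rewrite /= jP.
by exists idfun, j'; split=> // x; rewrite /= j'P.
Qed.
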